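(* Let $J^g(\mathbf{x})$ be continuously differentiable on $\mathbb{R}^3$ (independent of time) and represented by its Fourier series $$J^g(\mathbf{x})=\sum_{\mathbf{w}}\mathbf{a}_{\mathbf{w}}e^{i\mathbf{x}\cdot\mathbf{w}}=v_0+\sum_{\mathbf{w}\ne0}\sum_{1\le d\le3}\alpha_{d,\mathbf{w}}\mathbf{v}_{d,\mathbf{w}}e^{i\mathbf{x}\cdot\mathbf{w}},$$ where $v_0\in\mathbb{C}^3$ is constant. Define $$\phi(\mathbf{x})=v_0+\sum_{\mathbf{w}\ne0}\alpha_{1,\mathbf{w}}\mathbf{v}_{1,\mathbf{w}}e^{i\mathbf{x}\cdot\mathbf{w}},\qquad \psi(\mathbf{x})=\sum_{\mathbf{w}\ne0}\sum_{2\le d\le3}\frac{1}{\mu_{d,\mathbf{w}}}\alpha_{d,\mathbf{w}}\mathbf{v}_{d,\mathbf{w}}e^{i\mathbf{x}\cdot\mathbf{w}}.$$ Let $U,V$ be the solution of the system without the generator $J^g$, $$\frac{\partial V}{\partial t}=-\mathrm{curl}\,U,\quad \frac{\partial U}{\partial t}=\mathrm{curl}\,V,\quad V(\mathbf{x},0)=H_0(\mathbf{x})-\psi(\mathbf{x}),\quad U(\mathbf{x},0)=E_0(\mathbf{x}).$$ Then the solution of $$\frac{\partial\mathbf{H}}{\partial t}=-\mathrm{curl}\,\mathbf{E},\quad \frac{\partial\mathbf{E}}{\partial t}=\mathrm{curl}\,\mathbf{H}-J^g(\mathbf{x}),\quad \mathbf{H}(\mathbf{x},0)=H_0(\mathbf{x}),\quad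 \mathbf{E}(\mathbf{x},0)=E_0(\mathbf{x})$$ is given by $$\mathbf{E}(\mathbf{x},t)=U(\mathbf{x},t)-t\,\phi(\mathbf{x}),\qquad \mathbf{H}(\mathbf{x},t)=V(\mathbf{x},t)+\psi(\mathbf{x}).$$
   Context: Units are such that the permittivity and permeability are $\epsilon=\mu=1$. $H_0,E_0$ are the given initial fields. The sums run over the wave vectors $\mathbf{w}\in\mathbb{R}^3$ occurring in the Fourier series of $J^g$; the coefficients for $\mathbf{w}\neq0$ are $(\alpha_{1,\mathbf{w}},\alpha_{2,\mathbf{w}},\alpha_{3,\mathbf{w}})^T=V_{\mathbf{w}}^\dagger\mathbf{a}_{\mathbf{w}}$, where $V_{\mathbf{w}}$ is the matrix with columns $\mathbf{v}_{1,\mathbf{w}},\mathbf{v}_{2,\mathbf{w}},\mathbf{v}_{3,\mathbf{w}}$ defined below and $V_{\mathbf{w}}^\dagger$ its conjugate transpose. The curl acts in $\mathbf{x}$ and is extended complex-linearly. For $\mathbf{w}=(w_1,w_2,w_3)^T\in\mathbb{R}^3\setminus\{0\}$ put $s_{\mathbf{w}}=w_1+w_2+w_3$, $\mathbf{r}_{\mathbf{w}}=(w_2-w_3,w_3-w_1,w_1-w_2)^T$, $\nu_{\mathbf{w}}=\sqrt2\,|\mathbf{r}_{\mathbf{w}}|/|\mathbf{w}|$, and $\mu_{1,\mathbf{w}}=0$, $\mu_{2,\mathbf{w}}=-|\mathbf{w}|$, $\mu_{3,\mathbf{w}}=|\mathbf{w}|$. Put $\mathbf{v}_{1,\mathbf{w}}=\mathbf{w}/|\mathbf{w}|$.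 If $\mathbf{r}_{\mathbf{w}}\neq0$, put for $d=2,3$ $$\mathbf{v}_{d,\mathbf{w}}=\frac{1}{\nu_{\mathbf{w}}}\left(\frac{s_{\mathbf{w}}}{|\mathbf{w}|^2}\mathbf{w}-(1,1,1)^T-i\frac{\mu_{d,\mathbf{w}}}{|\mathbf{w}|^2}\mathbf{r}_{\mathbf{w}}\right).$$ If $\mathbf{r}_{\mathbf{w}}=0$, i.e. $w_1=w_2=w_3=\omega$, let $v_2=\frac{1}{\sqrt3}\left(\frac{1+i\sqrt3}{2},\frac{1-i\sqrt3}{2},-1\right)^T$ and put $\mathbf{v}_{2,\mathbf{w}}=v_2$ if $\omega\ge0$, $\mathbf{v}_{2,\mathbf{w}}=\overline{v_2}$ if $\omega<0$, and $\mathbf{v}_{3,\mathbf{w}}=\overline{\mathbf{v}_{2,\mathbf{w}}}$.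
   Formalization: Solutions are taken as continuously differentiable in (x,t); φ is additionally assumed continuously differentiable (J^g being so does not imply it, and E=U−tφ may otherwise have no curl), as are H_0 and E_0; ''the solution'' means uniqueness passes from the system without J^g. *)

(* Defs.v *)
From HB Require Import structures.
From mathcomp Require Import all_boot all_order all_algebra finmap.
From mathcomp Require Import complex.
From mathcomp Require Import all_classical all_reals all_analysis.

Set Implicit Arguments.
Unset Strict Implicit.
Unset Printing Implicit Defensive.

Import Order.TTheory GRing.Theory Num.Theory.
Import numFieldNormedType.Exports.

Local Open Scope ring_scope.
Local Open Scope complex_scope.
Local Open Scope classical_set_scope.

Section RealVectors.
Context {R : realType}.
Implicit Types (w x : 'cV[R]_3) (d : 'I_3).

(* The norm `|w| that the library puts on matrices is the sup norm. *)
Definition enorm w : R := Num.sqrt (\sum_j w j 0 ^+ 2).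

Definition dotp x w : R := \sum_j x j 0 * w j 0.

Definition csum w : R := \sum_j w j 0.

(* Indices are added modulo 3, so this is (w2 - w3, w3 - w1, w1 - w2)^T. *)
Definition rvec w : 'cV[R]_3 := \col_j (w (j + 1) 0 - w (j + 2) 0).

Definition nu w : R := Num.sqrt 2 * enorm (rvec w) / enorm w.

(* The index d = 0, 1, 2 stands for d = 1, 2, 3 in the usual numbering of the
   eigenvalues and eigenvectors. *)
Definition mu w d : R := [:: 0; - enorm w; enorm w]`_d.

End RealVectors.

Section Eigenvectors.
Context {R : realType}.
Implicit Types (w x : 'cV[R]_3) (d : 'I_3) (v a : 'cV[R[i]]_3).

Definition cplx w : 'cV[R[i]]_3 := map_mx (real_complex R) w.

Definition conjv v : 'cV[R[i]]_3 := map_mx (@conjc R) v.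

Definition expi (y : R) : R[i] := cos y +i* sin y.

Definition diag_eigvec : 'cV[R[i]]_3 :=
  ((Num.sqrt 3)^-1)%:C *:
    \col_(j < 3) [:: (1 / 2) +i* (Num.sqrt 3 / 2);
                     (1 / 2) -i* (Num.sqrt 3 / 2);
                     -1]`_j.

(* In the last case all three components of w are equal to w 0 0. *)
Definition eigvec w d : 'cV[R[i]]_3 :=
  if d == 0 then cplx ((enorm w)^-1 *: w)
  else if rvec w != 0 then
    ((nu w)^-1)%:C *:
      (cplx ((csum w / enorm w ^+ 2) *: w - const_mx 1)
       - ('i * (mu w d / enorm w ^+ 2)%:C) *: cplx (rvec w))
  else
    let v := if 0 <= w 0 0 then diag_eigvec else conjv diag_eigvec in
    if d == 1 then v else conjv v.

Definition eigmx w : 'M[R[i]]_3 := \matrix_(j, d) eigvec w d j 0.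

Definition adjmx (M : 'M[R[i]]_3) : 'M[R[i]]_3 := map_mx (@conjc R) M^T.

Definition alpha (a : 'cV[R]_3 -> 'cV[R[i]]_3) w d : R[i] :=
  (adjmx (eigmx w) *m a w) d 0.

End Eigenvectors.

Section FourierSums.
Context {R : realType}.
Implicit Types (x w : 'cV[R]_3) (a : 'cV[R]_3 -> 'cV[R[i]]_3).
Implicit Types (A : {fset 'cV[R]_3}).

Definition cvg_field (F : nat -> 'cV[R]_3 -> 'cV[R[i]]_3)
    (f : 'cV[R]_3 -> 'cV[R[i]]_3) : Prop :=
  forall x j, (complex.Re (F n x j 0) @[n --> \oo] --> complex.Re (f x j 0)) /\
              (complex.Im (F n x j 0) @[n --> \oo] --> complex.Im (f x j 0)).

(* The order of summation of a Fourier series (by cubes, by balls, along an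
   enumeration, ...) is an increasing sequence of finite sets of wave vectors
   that eventually contains each wave vector with a nonzero coefficient. *)
Definition exhausts a (W : nat -> {fset 'cV[R]_3}) : Prop :=
  (forall m n : nat, (m <= n)%N -> fsubset (W m) (W n)) /\
  (forall w, a w != 0 -> exists n, w \in W n).

Definition fourier_psum a A x : 'cV[R[i]]_3 :=
  \sum_(w <- A) expi (dotp x w) *: a w.

(* The constant v_0 is the coefficient of the wave vector 0, namely a 0. *)
Definition phi_psum a A x : 'cV[R[i]]_3 :=
  a 0 + \sum_(w <- A | w != 0) (alpha a w 0 * expi (dotp x w)) *: eigvec w 0.

Definition psi_psum a A x : 'cV[R[i]]_3 :=
  \sum_(w <- A | w != 0) \sum_(d < 3 | d != 0)
    (((mu w d)^-1)%:C * alpha a w d * expi (dotp x w)) *: eigvec w d.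

End FourierSums.

Section Maxwell.
Context {R : realType}.

(* Continuous differentiability, for functions on a finite-dimensional space. *)
Definition C1 (X : normedModType R) (f : X -> R) : Prop :=
  (forall x, differentiable f x) /\
  (forall v, continuous (fun x => 'D_v f x)).

Definition C1_field (X : normedModType R) (F : X -> 'cV[R[i]]_3) : Prop :=
  forall j, C1 (fun x => complex.Re (F x j 0)) /\
            C1 (fun x => complex.Im (F x j 0)).

Definition partial (k : 'I_3) (f : 'cV[R]_3 -> R[i]) (x : 'cV[R]_3) : R[i] :=
  ('D_(delta_mx k 0) (fun y => complex.Re (f y)) x) +i*
  ('D_(delta_mx k 0) (fun y => complex.Im (f y)) x).

(* Indices are added modulo 3. *)
Definition curl (F : 'cV[R]_3 -> 'cV[R[i]]_3) (x : 'cV[R]_3) : 'cV[R[i]]_3 :=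
  \col_j (partial (j + 1) (fun y => F y (j + 2) 0) x
          - partial (j + 2) (fun y => F y (j + 1) 0) x).

Definition time_deriv (f : R -> 'cV[R[i]]_3) (t : R) : 'cV[R[i]]_3 :=
  \col_j ((fun s => complex.Re (f s j 0))^`() t +i*
          (fun s => complex.Im (f s j 0))^`() t).

(* Classical solutions (H, E), with permittivity and permeability 1, of the
   Cauchy problem with generator G and initial fields H0, E0. *)
Definition maxwell (G H0 E0 : 'cV[R]_3 -> 'cV[R[i]]_3)
    (H E : 'cV[R]_3 -> R -> 'cV[R[i]]_3) : Prop :=
  [/\ C1_field (fun p : 'cV[R]_3 * R => H p.1 p.2) /\
      C1_field (fun p : 'cV[R]_3 * R => E p.1 p.2),
      forall x t, time_deriv (H x) t = - curl (fun y => E y t) x,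
      forall x t, time_deriv (E x) t = curl (fun y => H y t) x - G x,
      forall x, H x 0 = H0 x
    & forall x, E x 0 = E0 x].

End Maxwell.

(* Main.v *)
(* The fields (psi, - t phi) solve the system with generator J and initial data
   (psi, 0) as soon as curl phi = 0 and curl psi = J - phi; superposition then
   gives the theorem. Each wave satisfies i w x v_d = mu_d v_d and the v_d are
   orthonormal, so the partial sums satisfy curl phi_n = 0 and, eventually,
   curl psi_n = J_n - phi_n. The series are only assumed to converge pointwise,
   so the point is to pass these identities to the limit. Suppose that f_n and
   h_n tend to 0 pointwise while D_u h_n - D_v f_n tends to a continuous k with
   k > 0 somewhere. By Baire's theorem there are c > 0 and a ball on which, for
   all large n, |f_n|, |h_n| <= 1 and D_u h_n - D_v f_n >= c. On a small rectangle
   in that ball the circulation of (f_n, h_n) is then at least c times the area,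
   although it tends to 0 by dominated convergence. *)
Require Import Defs.
From HB Require Import structures.
From mathcomp Require Import all_boot all_order all_algebra finmap.
From mathcomp Require Import complex.
From mathcomp Require Import all_classical all_reals all_analysis.
From mathcomp Require Import ring lra.

Set Implicit Arguments.
Unset Strict Implicit.

Import Order.TTheory GRing.Theory Num.Theory.
Import numFieldNormedType.Exports.

Local Open Scope ring_scope.
Local Open Scope complex_scope.
Local Open Scope classical_set_scope.

(** * Circulation of a plane field around a rectangle *)

Section Circulation.
Context {R : realType}.
Local Notation mu := (@lebesgue_measure R).

Lemma continuous_itv_integrable (f : R -> R) (a b : R) :
  continuous f -> mu.-integrable `[a, b] (EFin \o f).
Proof.
move=> cf; apply: continuous_compact_integrable; first exact: segment_compact.
exact: continuous_subspaceT.
Qed.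

Lemma continuous_slicel (g : R * R -> R) (y : R) :
  continuous g -> continuous (fun x => g (x, y)).
Proof.
move=> cg x.
have cp : {for x, continuous (fun x : R => (x, y))}.
  exact: (cvg_pair cvg_id (cvg_cst _)).
exact: (continuous_comp cp (cg _)).
Qed.

Lemma continuous_slicer (g : R * R -> R) (x : R) :
  continuous g -> continuous (fun y => g (x, y)).
Proof.
move=> cg y.
have cp : {for y, continuous (fun y : R => (x, y))}.
  exact: (cvg_pair (cvg_cst _) cvg_id).
exact: (continuous_comp cp (cg _)).
Qed.

(** The mean value theorem for the single function $\int_a^x u - v$ gives one point for both terms.
    Used once in each variable, this replaces a double integral. *)
Lemma Rintegral_increment_MVT (u v dv : R -> R) (a b : R) : a < b ->
  continuous u -> (forall x : R, is_derive x 1 v (dv x)) ->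
  exists2 c, c \in `]a, b[%R &
    \int[mu]_(x in `[a, b]) u x - (v b - v a) = (u c - dv c) * (b - a).
Proof.
move=> ab cu dvE.
pose F x := \int[mu]_(t in `[a, x]) u t.
have dF (x : R) : x \in `]a, b[%R -> is_derive x 1 (F - v) (u x - dv x).
  rewrite in_itv/= => /andP[ax xb]; apply: is_deriveB.
  have [d1 d2] := continuous_FTC1_closed xb (@continuous_itv_integrable u a b cu)
    ax (cu x).
  by rewrite -d2 derive1E; apply: derivableP.
have cF : {within `[a, b], continuous (F - v)}.
  move=> x; apply: continuousB.
    by apply: parameterized_integral_continuous;
      [exact: ltW|exact: continuous_itv_integrable].
  apply: continuous_subspaceT => y.
  exact/differentiable_continuous/derivable1_diffP/ex_derive.
have [c cab] := MVT ab dF cF.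
rewrite !fctE /F set_itv1 Rintegral_set1 => E; exists c => //.
by rewrite -E; ring.
Qed.

Lemma is_derive_Rintegral (h hx : R * R -> R) (c d : R) :
  continuous h -> continuous hx ->
  (forall x y : R, is_derive x 1 (fun s => h (s, y)) (hx (x, y))) ->
  forall x : R, is_derive x 1 (fun s => \int[mu]_(y in `[c, d]) h (s, y))
    (\int[mu]_(y in `[c, d]) hx (x, y)).
Proof.
move=> ch chx dh x.
have d1 s y : partial1of2 (fun s y => h (s, y)) s y = hx (s, y).
  by rewrite /partial1of2 derive1E; apply: derive_val.
(* [hx] is bounded on the compact set $[x-1,x+1]\times[c,d]$; the constant [M] is the dominating
   function for differentiation under the integral. *)
have [M M0 hM] : exists2 M, 0 <= M & forall s y, s \in `[x - 1, x + 1]%R ->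
    y \in `[c, d]%R -> `|hx (s, y)| <= M.
  have : bounded_set (hx @` (`[x - 1, x + 1] `*` `[c, d])).
    apply: compact_bounded; apply: continuous_compact.
      exact: continuous_subspaceT.
    by apply: compact_setX; exact: segment_compact.
  case=> M [Mr bM]; exists (`|M| + 1); first by rewrite addr_ge0.
  move=> s y sx yc; apply: bM => /=; last by exists (s, y).
  by rewrite (le_lt_trans (ler_norm _))// ltrDl.
have xI : `]x - 1, x + 1[%classic x by rewrite /= in_itv/=; apply/andP; split; lra.
have mI : measurable `[c, d]%classic by [].
have iI s : `]x - 1, x + 1[%classic s ->
    mu.-integrable `[c, d] (EFin \o (fun y => h (s, y))).
  by move=> _; apply: continuous_itv_integrable; exact: continuous_slicer.
have derI s y : `]x - 1, x + 1[%classic s -> `[c, d]%classic y ->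
    derivable (fun s => h (s, y)) s 1.
  by move=> _ _; exact: ex_derive.
have iM : mu.-integrable `[c, d] (EFin \o cst M).
  by apply: continuous_itv_integrable => ?; exact: cvg_cst.
have bM s y : `]x - 1, x + 1[%classic s -> `[c, d]%classic y ->
    `|partial1of2 (fun s y => h (s, y)) s y| <= M.
  by move=> /subset_itv_oo_cc sx yc; rewrite d1; exact: hM.
have D := @derivable_under_integral _ _ _ mu (fun s y => h (s, y)) _
  mI _ _ _ xI iI derI (cst M) (fun=> M0) iM bM.
apply: DeriveDef; first exact: D.
rewrite -derive1E (@differentiation_under_integral _ _ _ mu
  (fun s y => h (s, y)) _ mI _ _ _ xI iI derI (cst M) (fun=> M0) iM bM).
by apply: eq_Rintegral => y _; exact: d1.
Qed.

(* Green's formula with its double integral replaced by a mean value. *)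
Lemma circulation_MVT (f h fy hx : R * R -> R) (a b c d : R) :
  a < b -> c < d ->
  continuous f -> continuous h -> continuous hx ->
  (forall x y : R, is_derive y 1 (fun t => f (x, t)) (fy (x, y))) ->
  (forall x y : R, is_derive x 1 (fun s => h (s, y)) (hx (x, y))) ->
  exists2 p, p.1 \in `]a, b[%R /\ p.2 \in `]c, d[%R &
    (\int[mu]_(y in `[c, d]) h (b, y) - \int[mu]_(y in `[c, d]) h (a, y))
    - \int[mu]_(x in `[a, b]) (f (x, d) - f (x, c))
    = (hx p - fy p) * (d - c) * (b - a).
Proof.
move=> ab cd cf ch chx df dh.
have cfdc : continuous (fun x => f (x, d) - f (x, c)).
  by move=> x; apply: continuousB; exact: continuous_slicel.
(* The mean value in the first variable leaves, on the vertical line through [x], the integral of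
   [hx] minus an increment of [f]. This is again of the same form, now in the second variable. *)
have [x xab Ex] := Rintegral_increment_MVT ab cfdc (@is_derive_Rintegral h hx c d ch chx dh).
have [y ycd Ey] := Rintegral_increment_MVT cd (@continuous_slicer hx x chx) (df x).
exists (x, y) => //.
rewrite -Ey -[LHS]opprK opprB Ex; ring.
Qed.

End Circulation.

(** * Curls of pointwise limits *)

Section PointwiseLimits.
Context {R : realType}.
Local Notation mu := (@lebesgue_measure R).

Lemma Rintegral_bounded_cvg0 (F : nat -> R -> R) (a b M : R) :
  (forall n, continuous (F n)) ->
  (forall x, x \in `[a, b]%R -> F n x @[n --> \oo] --> 0) ->
  (forall n x, x \in `[a, b]%R -> `|F n x| <= M) ->
  \int[mu]_(x in `[a, b]) F n x @[n --> \oo] --> 0.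
Proof.
move=> cF F0 FM.
have : (\int[mu]_(x in `[a, b]) (F n x)%:E)%E @[n --> \oo] -->
    (\int[mu]_(x in `[a, b]) 0)%E.
  apply: (@dominated_cvg _ _ _ mu _ _ (fun n x => (F n x)%:E) (fun=> 0%E)
    (fun=> M%:E)) => //.
  - by move=> n; have /integrableP[] := @continuous_itv_integrable _ _ a b (cF n).
  - by move=> x xab; apply: cvg_EFin; [exact: nearW|exact: F0].
  - apply: (@continuous_itv_integrable _ (cst M)) => ?; exact: cvg_cst.
by rewrite integral0 => /fine_cvg.
Qed.

(** The difference quotients of the restriction to a line are those of [f] in the direction [v].
    This moves directional derivatives in [X] to the parameter plane of a rectangle. *)
Lemma is_derive_line (X : normedModType R) (f : X -> R) (q v : X) (t : R) :
  differentiable f (q + t *: v) ->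
  is_derive t 1 (fun t => f (q + t *: v)) ('D_v f (q + t *: v)).
Proof.
move=> df.
have E : (fun h : R => h^-1 *: (((fun t => f (q + t *: v)) \o shift t) (h *: 1)
    - f (q + t *: v))) = (fun h => h^-1 *: ((f \o shift (q + t *: v)) (h *: v)
    - f (q + t *: v))).
  apply/funext => h /=; congr (_ *: (f _ - _)).
  by rewrite scaler1 scalerDl addrCA.
apply: DeriveDef; last by rewrite /derive E.
by rewrite /derivable E; exact: diff_derivable.
Qed.

Lemma C1_continuous (X : normedModType R) (f : X -> R) : C1 f -> continuous f.
Proof. by move=> [df _] x; apply: differentiable_continuous. Qed.

Lemma C1D (X : normedModType R) (f g : X -> R) : C1 f -> C1 g -> C1 (f + g).
Proof.
move=> [df cf] [dg cg]; split=> [x|v x]; first exact: differentiableD.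
have -> : (fun x => 'D_v (f + g) x) = (fun x => 'D_v f x + 'D_v g x).
  by apply/funext => y; rewrite deriveD//; exact: diff_derivable.
by apply: cvgD; [exact: cf|exact: cg].
Qed.

Lemma C1N (X : normedModType R) (f : X -> R) : C1 f -> C1 (- f).
Proof.
move=> [df cf]; split=> [x|v x]; first exact: differentiableN.
have -> : (fun x => 'D_v (- f) x) = (fun x => - 'D_v f x).
  by apply/funext => y; rewrite deriveN//; exact: diff_derivable.
by apply: cvgN; exact: cf.
Qed.

Lemma C1B (X : normedModType R) (f g : X -> R) : C1 f -> C1 g -> C1 (f - g).
Proof. by move=> Cf Cg; apply: C1D => //; exact: C1N. Qed.

Lemma curl_cvg0_le0 (X : completeNormedModType R) (u v : X)
    (f h : nat -> X -> R) (k : X -> R) :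
  (forall n, C1 (f n)) -> (forall n, C1 (h n)) ->
  (forall x, f n x @[n --> \oo] --> 0) -> (forall x, h n x @[n --> \oo] --> 0) ->
  (forall x, 'D_u (h n) x - 'D_v (f n) x @[n --> \oo] --> k x) ->
  continuous k -> forall x, k x <= 0.
Proof.
move=> Cf Ch f0 h0 gk ck x0; rewrite leNgt; apply/negP => kx0.
pose g n x := 'D_u (h n) x - 'D_v (f n) x.
have cg n : continuous (g n).
  by move=> x; apply: cvgB; [exact: (Ch n).2|exact: (Cf n).2].
(* This lies below the threshold [k x0 / 2] that cuts out an open set further on, so there [c < k x]
   strictly and [c <= g n x] for all large [n]. *)
pose c := k x0 / 4.
pose A N := \bigcap_(n in [set n | (N <= n)%N])
  ((fun x => `|f n x|) @^-1` [set y | y <= 1] `&`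
   (fun x => `|h n x|) @^-1` [set y | y <= 1] `&`
   g n @^-1` [set y | c <= y]).
have clA N : closed (A N).
  apply: closed_bigI => n _; apply: closedI; first apply: closedI.
  - apply: closed_comp; last exact: closed_le.
    move=> x _; apply: (@continuous_comp _ _ _ (f n)).
      exact: C1_continuous.
    exact: norm_continuous.
  - apply: closed_comp; last exact: closed_le.
    move=> x _; apply: (@continuous_comp _ _ _ (h n)).
      exact: C1_continuous.
    exact: norm_continuous.
  - by apply: closed_comp; [move=> x _; exact: cg|exact: closed_ge].
(* If no [A N] had interior points, the complements would be open and dense, and by Baire some [x]
   with [k x > k x0 / 2] would avoid every [A N]. Pointwise convergence at [x] puts it in one of
   them. *)
have [N [B [B0 [oB BA]]]] : exists N, exists B : set X,
    B !=set0 /\ open B /\ B `<=` A N.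
  apply: contrapT => noN.
  have /Baire : forall N, open (~` A N) /\ dense (~` A N).
    move=> N; split; first by rewrite openC.
    move=> B B0 oB; apply/set0P/negP => /eqP BA; apply: noN.
    by exists N, B; split=> //; split=> //; apply/subsets_disjoint.
  have ok : open (k @^-1` [set y | k x0 / 2 < y]).
    by apply: open_comp; [move=> x _; exact: ck|exact: open_gt].
  have nk : (k @^-1` [set y | k x0 / 2 < y]) !=set0.
    by exists x0 => /=; lra.
  move=> /(_ _ nk ok)[x [/= kx xA]].
  have ckx : c < k x by rewrite /c; lra.
  have [N _ HN] : \forall n \near \oo, `|f n x| <= 1 /\ `|h n x| <= 1 /\ c <= g n x.
    have E1 : \forall n \near \oo, `|f n x| <= 1.
      by have /cvgrPdist_le/(_ 1 ltr01) := f0 x; apply: filterS => n;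
        rewrite sub0r normrN.
    have E2 : \forall n \near \oo, `|h n x| <= 1.
      by have /cvgrPdist_le/(_ 1 ltr01) := h0 x; apply: filterS => n;
        rewrite sub0r normrN.
    have E3 : \forall n \near \oo, c <= g n x by exact: cvgr_ge (gk x) _ ckx.
    by move: E1 E2 E3; apply: filterS3.
  by apply: (xA N) => // n /= /HN [? [? ?]].
move: B0 => [p Bp].
have [r /= r0 rB] : exists2 r : R, 0 < r & ball p r `<=` B.
  by have /nbhs_ballP[r r0 ?] := open_nbhs_nbhs (conj oB Bp); exists r.
(* Points of the parallelogram with sides [e *: u] and [e *: v] are at distance at most $e(|u|+|v|)
   < r$ from the corner [p]. Adding 1 keeps the denominator positive when [u] and [v] both
   vanish. *)
pose e := r / (`|u| + `|v| + 1) / 2.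
have D0 : 0 < `|u| + `|v| + 1 by rewrite ltr_wpDl// addr_ge0.
have e0 : 0 < e by rewrite !divr_gt0.
(* The circulation is taken in the parameter square $[0,e]^2$, so that linearly dependent [u] and
   [v] cause no trouble. *)
pose P (q : R * R) : X := p + q.1 *: u + q.2 *: v.
have PA q : q.1 \in `[0, e]%R -> q.2 \in `[0, e]%R -> A N (P q).
  rewrite !in_itv/= => /andP[q10 q1e] /andP[q20 q2e]; apply/BA/rB.
  rewrite -ball_normE /ball_/= /P -addrA opprD addNKr normrN.
  apply: (le_lt_trans (ler_normD _ _)); rewrite !normrZ !ger0_norm//.
  apply: (@le_lt_trans _ _ (e * `|u| + e * `|v|)).
    by rewrite lerD// ler_wpM2r.
  have -> : r = e * (`|u| + `|v| + 1) * 2 by rewrite /e; field; rewrite gt_eqF.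
  by have := normr_ge0 u; have := normr_ge0 v; nra.
have cP : continuous P.
  move=> q; apply: cvgD; first apply: cvgD.
  - exact: cvg_cst.
  - by apply: cvgZr_tmp; exact: cvg_fst.
  - by apply: cvgZr_tmp; exact: cvg_snd.
have cfP (w : X -> R) : continuous w -> continuous (w \o P).
  by move=> cw q; apply: continuous_comp; [exact: cP|exact: cw].
have P1 x y : P (x, y) = (p + y *: v) + x *: u by rewrite /P addrAC.
have circ n := @circulation_MVT R (f n \o P) (h n \o P)
  ((fun x => 'D_v (f n) x) \o P) ((fun x => 'D_u (h n) x) \o P) 0 e 0 e e0 e0
  (cfP _ (C1_continuous (Cf n))) (cfP _ (C1_continuous (Ch n)))
  (cfP _ ((Ch n).2 u))
  (fun x y => @is_derive_line X (f n) (p + x *: u) v y ((Cf n).1 _)).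
have dh n (x y : R) : is_derive x 1 (fun s => (h n \o P) (s, y))
    (((fun x => 'D_u (h n) x) \o P) (x, y)).
  rewrite /= P1; under eq_fun do rewrite P1.
  exact/is_derive_line/(Ch n).1.
(* The index is shifted by [N] so that the bounds defining [A N] hold for every term, as domination
   requires. *)
pose I1 n := \int[mu]_(y in `[0, e]) (h (n + N)%N \o P) (e, y).
pose I0 n := \int[mu]_(y in `[0, e]) (h (n + N)%N \o P) (0, y).
pose J n := \int[mu]_(x in `[0, e])
  ((f (n + N)%N \o P) (x, e) - (f (n + N)%N \o P) (x, 0)).
have ge n : c * e * e <= I1 n - I0 n - J n.
  have [q [q1 q2] ->] := circ (n + N)%N (dh (n + N)%N).
  rewrite !subr0 !ler_pM2r//.
  have := PA q (subset_itv_oo_cc q1) (subset_itv_oo_cc q2).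
  by move=> /(_ (n + N)%N (leq_addl _ _))[].
have m0 : 0 \in `[0, e]%R by rewrite in_itv/= lexx ltW.
have me : e \in `[0, e]%R by rewrite in_itv/= lexx ltW.
have hb n q : q.1 \in `[0, e]%R -> q.2 \in `[0, e]%R ->
    `|h (n + N)%N (P q)| <= 1.
  by move=> q1 q2; have [[]] := PA q q1 q2 (n + N)%N (leq_addl _ _).
have fb n q : q.1 \in `[0, e]%R -> q.2 \in `[0, e]%R ->
    `|f (n + N)%N (P q)| <= 1.
  by move=> q1 q2; have [[]] := PA q q1 q2 (n + N)%N (leq_addl _ _).
have I1c : I1 n @[n --> \oo] --> 0.
  apply: (@Rintegral_bounded_cvg0 (fun n y => (h (n + N)%N \o P) (e, y)) _ _ 1).
  - by move=> n; apply/continuous_slicer/cfP/C1_continuous.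
  - by move=> x _; rewrite (cvg_shiftn N (fun n => h n (P (e, x)))); exact: h0.
  - by move=> n x xe; exact: hb.
have I0c : I0 n @[n --> \oo] --> 0.
  apply: (@Rintegral_bounded_cvg0 (fun n y => (h (n + N)%N \o P) (0, y)) _ _ 1).
  - by move=> n; apply/continuous_slicer/cfP/C1_continuous.
  - by move=> x _; rewrite (cvg_shiftn N (fun n => h n (P (0, x)))); exact: h0.
  - by move=> n x xe; exact: hb.
have Jc : J n @[n --> \oo] --> 0.
  apply: (@Rintegral_bounded_cvg0 (fun n x =>
    (f (n + N)%N \o P) (x, e) - (f (n + N)%N \o P) (x, 0)) _ _ 2).
  - move=> n x; apply: cvgB.
      exact: (@continuous_slicel _ _ e (cfP _ (C1_continuous (Cf _)))).
    exact: (@continuous_slicel _ _ 0 (cfP _ (C1_continuous (Cf _)))).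
  - move=> x _; rewrite (cvg_shiftn N (fun n => f n (P (x, e)) - f n (P (x, 0)))).
    have := cvgB (f0 (P (x, e))) (f0 (P (x, 0))); rewrite subr0; move=> Z.
    exact: Z.
  - move=> n x xe; apply: (le_trans (ler_normB _ _)).
    exact: (lerD (fb n (x, e) xe me) (fb n (x, 0) xe m0)).
have L : I1 n - I0 n - J n @[n --> \oo] --> 0 - 0 - 0.
  by apply: cvgB => //; apply: cvgB.
have c0 : 0 < c by rewrite /c; lra.
have : c * e * e <= 0 - 0 - 0 by apply: (cvgr_to_ge L); exact: nearW.
by rewrite !subr0 leNgt !mulr_gt0.
Qed.

(** Convergence of [f n] and [h n] says nothing about their derivatives; only the combination is
    known to converge. Subtracting [f'] and [h'] reduces to sequences tending to 0, where
    [curl_cvg0_le0] applies to both [K] and [- K]. *)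
Lemma pointwise_limit_curl (X : completeNormedModType R) (u v : X)
    (f h : nat -> X -> R) (f' h' k : X -> R) :
  (forall n, C1 (f n)) -> (forall n, C1 (h n)) -> C1 f' -> C1 h' ->
  (forall x, f n x @[n --> \oo] --> f' x) ->
  (forall x, h n x @[n --> \oo] --> h' x) ->
  (forall x, 'D_u (h n) x - 'D_v (f n) x @[n --> \oo] --> k x) ->
  continuous k -> forall x, 'D_u h' x - 'D_v f' x = k x.
Proof.
move=> Cf Ch Cf' Ch' ff' hh' gk ck x.
pose F n := f n - f'; pose H n := h n - h'.
pose K x := k x - ('D_u h' x - 'D_v f' x).
have CF n : C1 (F n) by exact: C1B.
have CH n : C1 (H n) by exact: C1B.
have F0 y : F n y @[n --> \oo] --> 0 by apply/subr_cvg0; exact: ff'.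
have H0 y : H n y @[n --> \oo] --> 0 by apply/subr_cvg0; exact: hh'.
have DE n y : 'D_u (H n) y - 'D_v (F n) y =
    'D_u (h n) y - 'D_v (f n) y - ('D_u h' y - 'D_v f' y).
  rewrite !deriveB; [ring|apply: diff_derivable..].
  - exact: (Cf n).1.
  - exact: Cf'.1.
  - exact: (Ch n).1.
  - exact: Ch'.1.
have GK y : 'D_u (H n) y - 'D_v (F n) y @[n --> \oo] --> K y.
  by under eq_fun do rewrite DE; apply: cvgB; [exact: gk|exact: cvg_cst].
have cK : continuous K.
  move=> y; apply: cvgB; first exact: ck.
  by apply: cvgB; [exact: Ch'.2|exact: Cf'.2].
have le0 := curl_cvg0_le0 CF CH F0 H0 GK cK x.
have ge0 : - K x <= 0.
  apply: (@curl_cvg0_le0 _ u v (fun n => - F n) (fun n => - H n) (fun x => - K x)).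
  - by move=> n; exact: C1N.
  - by move=> n; exact: C1N.
  - by move=> y; rewrite -oppr0; apply: cvgN; exact: F0.
  - by move=> y; rewrite -oppr0; apply: cvgN; exact: H0.
  - move=> y; under eq_fun => n.
      rewrite !deriveN; [|apply: diff_derivable; exact: (CF n).1
        |apply: diff_derivable; exact: (CH n).1].
      rewrite -opprD; over.
    by apply: cvgN; exact: GK.
  - by move=> y; apply: cvgN; exact: cK.
by apply/eqP; rewrite eq_sym -subr_eq0 eq_le le0 -oppr_le0.
Qed.
End PointwiseLimits.

(** * Complex-valued functions of class $C^1$ and plane waves *)

Section ComplexFields.
Context {R : realType}.
Implicit Types (X : normedModType R) (w : 'cV[R]_3).

Lemma Re_add (x y : R[i]) : complex.Re (x + y) = complex.Re x + complex.Re y.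
Proof. by case: x y => [? ?] [? ?]. Qed.

Lemma Im_add (x y : R[i]) : complex.Im (x + y) = complex.Im x + complex.Im y.
Proof. by case: x y => [? ?] [? ?]. Qed.

Lemma Re_opp (x : R[i]) : complex.Re (- x) = - complex.Re x.
Proof. by case: x. Qed.

Lemma Im_opp (x : R[i]) : complex.Im (- x) = - complex.Im x.
Proof. by case: x. Qed.

Lemma Re_mul (x y : R[i]) :
  complex.Re (x * y) = complex.Re x * complex.Re y - complex.Im x * complex.Im y.
Proof. by case: x y => [? ?] [? ?]. Qed.

Lemma Im_mul (x y : R[i]) :
  complex.Im (x * y) = complex.Re x * complex.Im y + complex.Im x * complex.Re y.
Proof. by case: x y => [? ?] [? ?]. Qed.

Lemma complex_eqP (x y : R[i]) :
  complex.Re x = complex.Re y -> complex.Im x = complex.Im y -> x = y.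
Proof. by case: x y => [? ?] [? ?] /= -> ->. Qed.

Lemma cplx_mulE (a b c d : R) :
  (a +i* b) * (c +i* d) = (a * c - b * d) +i* (a * d + b * c).
Proof. by []. Qed.

(** Convertible with the condition that [C1_field] imposes on each component, so the closure lemmas
    below apply to fields entrywise. *)
Definition C1c X (f : X -> R[i]) :=
  C1 (fun x => complex.Re (f x)) /\ C1 (fun x => complex.Im (f x)).

(** A common form of [partial] and of the entries of [time_deriv]: the calculus is done once, for
    any direction in any normed space. *)
Definition cderive X (v : X) (f : X -> R[i]) (x : X) : R[i] :=
  'D_v (fun y => complex.Re (f y)) x +i* 'D_v (fun y => complex.Im (f y)) x.

Lemma C1M X (f g : X -> R) : C1 f -> C1 g -> C1 (fun x => f x * g x).
Proof.
move=> Cf Cg; have [df cf] := Cf; have [dg cg] := Cg.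
split=> [x|v]; first exact: differentiableM.
have -> : (fun x => 'D_v (fun x => f x * g x) x) =
    (fun x => f x * 'D_v g x + g x * 'D_v f x).
  by apply/funext => y; rewrite deriveM//; exact: diff_derivable.
move=> x; apply: cvgD; apply: cvgM; first exact: C1_continuous.
- exact: cg.
- exact: C1_continuous.
- exact: cf.
Qed.

Lemma C1_cst X (c : R) : C1 (fun _ : X => c).
Proof.
split=> [x|v]; first exact: differentiable_cst.
have -> : (fun x : X => 'D_v (fun=> c) x) = cst 0.
  by apply/funext => x; exact: derive_cst.
by move=> x; exact: cvg_cst.
Qed.

Lemma C1_diff X (f : X -> R) x : C1 f -> differentiable f x.
Proof. by case. Qed.

Lemma C1_derivable X (f : X -> R) x v : C1 f -> derivable f x v.
Proof. by move=> /C1_diff df; exact: diff_derivable. Qed.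

Lemma C1cD X (f g : X -> R[i]) : C1c f -> C1c g -> C1c (fun x => f x + g x).
Proof.
move=> [f1 f2] [g1 g2]; split.
  by under eq_fun do rewrite Re_add; exact: C1D.
by under eq_fun do rewrite Im_add; exact: C1D.
Qed.

Lemma C1cM X (f g : X -> R[i]) : C1c f -> C1c g -> C1c (fun x => f x * g x).
Proof.
move=> [f1 f2] [g1 g2]; split.
  by under eq_fun do rewrite Re_mul; apply: C1B; exact: C1M.
by under eq_fun do rewrite Im_mul; apply: C1D; exact: C1M.
Qed.

Lemma C1c_cst X (c : R[i]) : C1c (fun _ : X => c).
Proof. by split; exact: C1_cst. Qed.

Lemma cderive_cst X (v : X) (c : R[i]) x : cderive v (fun=> c) x = 0.
Proof. by rewrite /cderive !derive_cst. Qed.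

Lemma cderiveD X (v : X) (f g : X -> R[i]) x : C1c f -> C1c g ->
  cderive v (fun x => f x + g x) x = cderive v f x + cderive v g x.
Proof.
move=> [f1 f2] [g1 g2]; rewrite /cderive.
under eq_fun do rewrite Re_add.
under [X in _ +i* 'D_v X _]eq_fun do rewrite Im_add.
have d1 := @C1_derivable X _ x v f1; have d2 := @C1_derivable X _ x v f2.
have e1 := @C1_derivable X _ x v g1; have e2 := @C1_derivable X _ x v g2.
by rewrite (deriveD d1 e1) (deriveD d2 e2).
Qed.

Lemma cderiveM X (v : X) (f g : X -> R[i]) x : C1c f -> C1c g ->
  cderive v (fun x => f x * g x) x = f x * cderive v g x + g x * cderive v f x.
Proof.
move=> [f1 f2] [g1 g2]; rewrite /cderive.
under eq_fun do rewrite Re_mul.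
under [X in _ +i* 'D_v X _]eq_fun do rewrite Im_mul.
have d1 := @C1_derivable X _ x v f1; have d2 := @C1_derivable X _ x v f2.
have e1 := @C1_derivable X _ x v g1; have e2 := @C1_derivable X _ x v g2.
rewrite (deriveB (derivableM d1 e1) (derivableM d2 e2)).
rewrite (deriveD (derivableM d1 e2) (derivableM d2 e1)).
rewrite (deriveM d1 e1) (deriveM d2 e2) (deriveM d1 e2) (deriveM d2 e1).
move: ('D_v _ x) ('D_v _ x) ('D_v _ x) ('D_v _ x) => Df1 Df2 Dg1 Dg2.
case: (f x) (g x) => [a b] [c d]; rewrite !cplx_mulE.
by apply: complex_eqP; rewrite /= /GRing.scale/=; ring.
Qed.

Lemma cderiveZ X (v : X) (c : R[i]) (f : X -> R[i]) x : C1c f ->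
  cderive v (fun x => c * f x) x = c * cderive v f x.
Proof.
by move=> Cf; rewrite (cderiveM v x (C1c_cst X c) Cf) cderive_cst mulr0 addr0.
Qed.

Lemma dotpDl x y w : dotp (x + y) w = dotp x w + dotp y w.
Proof.
by rewrite /dotp -big_split; apply: eq_bigr => j _; rewrite mxE mulrDl.
Qed.

Lemma dotpZl c x w : dotp (c *: x) w = c * dotp x w.
Proof. by rewrite /dotp mulr_sumr; apply: eq_bigr => j _; rewrite mxE mulrA. Qed.

Lemma dotp_delta k w : dotp (delta_mx k 0) w = w k 0.
Proof.
rewrite /dotp (bigD1 k)//= mxE !eqxx mul1r big1 ?addr0// => j /negPf jk.
by rewrite mxE jk mul0r.
Qed.

Lemma differentiable_dotp w x : differentiable (fun x => dotp x w) x.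
Proof.
have -> : (fun x : 'cV[R]_3 => dotp x w) =
    \sum_(j < 3) (fun x : 'cV[R]_3 => x j 0 * w j 0).
  by apply/funext => y; rewrite /dotp fct_sumE.
apply: differentiable_sum => j.
exact: (differentiableM (differentiable_coord _ _ _) (differentiable_cst _ _)).
Qed.

(** The wave depends on [x] only through the linear form [dotp x w], so its difference quotient in
    the direction [v] is one of the profile [g] in the direction [dotp v w]. The profiles of
    interest are [cos] and [sin]. *)
Lemma C1_plane_wave (g g' : R -> R) w :
  (forall y : R, is_derive y 1 g (g' y)) -> continuous g' ->
  C1 (fun x => g (dotp x w)) /\
  forall v x, 'D_v (fun x => g (dotp x w)) x = dotp v w * g' (dotp x w).
Proof.
move=> dg cg'.
have dfg y : differentiable g y by apply/derivable1_diffP/ex_derive.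
have cd : continuous (fun x => dotp x w).
  by move=> x; apply: differentiable_continuous; exact: differentiable_dotp.
have DE v x : 'D_v (fun x => g (dotp x w)) x = dotp v w * g' (dotp x w).
  have -> : 'D_v (fun x => g (dotp x w)) x = 'D_(dotp v w) g (dotp x w).
    have E : (fun h : R => h^-1 *: (((fun x => g (dotp x w)) \o shift x) (h *: v)
          - g (dotp x w))) =
        (fun h => h^-1 *: ((g \o shift (dotp x w)) (h *: dotp v w)
          - g (dotp x w))).
      by apply/funext => h /=; rewrite dotpDl dotpZl.
    by rewrite /derive E.
  rewrite deriveE// -[X in 'd _ _ X]mulr1 -[_ * 1]/(_ *: _) linearZ/=.
  by rewrite -deriveE// derive_val.
split=> //; split=> [x|v].
  exact: (differentiable_comp (differentiable_dotp w x) (dfg _)).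
rewrite (_ : (fun x => _) = fun x => dotp v w * g' (dotp x w)); last first.
  by apply/funext => x; exact: DE.
move=> x; have cgx := continuous_comp (cd x) (cg' _).
exact: (cvgM (cvg_cst _) cgx).
Qed.

Lemma C1c_expi w : C1c (fun x => expi (dotp x w)).
Proof.
split.
  by have [] := @C1_plane_wave cos (fun y => - sin y) w (@is_derive_cos R)
    (fun y => cvgN (@continuous_sin R y)).
by have [] := @C1_plane_wave sin cos w (@is_derive_sin R) (@continuous_cos R).
Qed.

Lemma cderive_expi v w x : cderive v (fun x => expi (dotp x w)) x =
  'i * (dotp v w)%:C * expi (dotp x w).
Proof.
rewrite /cderive/=.
have [_ ->] := @C1_plane_wave cos (fun y => - sin y) w (@is_derive_cos R)
    (fun y => cvgN (@continuous_sin R y)).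
have [_ ->] := @C1_plane_wave sin cos w (@is_derive_sin R) (@continuous_cos R).
by apply: complex_eqP; rewrite ?cplx_mulE/=; ring.
Qed.

End ComplexFields.

(* Both structures are in the library, but not declared jointly. *)
HB.instance Definition _ (R : realType) (m n : nat) :=
  NormedModule.on 'M[R]_(m, n).

(** * The curl and its symbol on plane waves *)

Section Curl.
Context {R : realType}.
Implicit Types (F G : 'cV[R]_3 -> 'cV[R[i]]_3) (w : 'cV[R]_3).

(* The symbol of the curl: the vector i w x v. *)
Definition ccross w (v : 'cV[R[i]]_3) : 'cV[R[i]]_3 :=
  \col_j ('i * ((w (j + 1) 0)%:C * v (j + 2) 0 - (w (j + 2) 0)%:C * v (j + 1) 0)).

Lemma ccrossE w (v : 'cV[R[i]]_3) j : ccross w v j 0 =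
  'i * ((w (j + 1) 0)%:C * v (j + 2) 0 - (w (j + 2) 0)%:C * v (j + 1) 0).
Proof. by rewrite mxE. Qed.

Lemma C1_fieldD (X : normedModType R) (F G : X -> 'cV[R[i]]_3) :
  C1_field F -> C1_field G -> C1_field (fun x => F x + G x).
Proof.
move=> CF CG j; suff : C1c (fun x => (F x + G x) j 0) by [].
have -> : (fun x => (F x + G x) j 0) = fun x => F x j 0 + G x j 0.
  by apply/funext => x; rewrite mxE.
exact: (C1cD (CF j) (CG j)).
Qed.

Lemma C1_fieldZ (X : normedModType R) (c : X -> R[i]) (F : X -> 'cV[R[i]]_3) :
  C1c c -> C1_field F -> C1_field (fun x => c x *: F x).
Proof.
move=> Cc CF j; suff : C1c (fun x => (c x *: F x) j 0) by [].
have -> : (fun x => (c x *: F x) j 0) = fun x => c x * F x j 0.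
  by apply/funext => x; rewrite mxE.
exact: (C1cM Cc (CF j)).
Qed.

Lemma C1_field_cst (X : normedModType R) (v : 'cV[R[i]]_3) :
  C1_field (fun _ : X => v).
Proof. by move=> j; exact: C1c_cst. Qed.

Lemma curlE F x j : curl F x j 0 =
  cderive (delta_mx (j + 1) 0) (fun y => F y (j + 2) 0) x
  - cderive (delta_mx (j + 2) 0) (fun y => F y (j + 1) 0) x.
Proof. by rewrite mxE. Qed.

Lemma curlD F G x : C1_field F -> C1_field G ->
  curl (fun x => F x + G x) x = curl F x + curl G x.
Proof.
move=> CF CG; apply/colP => j; rewrite [RHS]mxE !curlE.
have E k : (fun y => (F y + G y) k 0) = fun y => F y k 0 + G y k 0.
  by apply/funext => y; rewrite mxE.
rewrite !E !(cderiveD _ _ (CF _) (CG _)).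
by rewrite opprD addrACA.
Qed.

Lemma curlZ (c : R[i]) F x : C1_field F ->
  curl (fun x => c *: F x) x = c *: curl F x.
Proof.
move=> CF; apply/colP => j; rewrite [RHS]mxE !curlE.
have E k : (fun y => (c *: F y) k 0) = fun y => c * F y k 0.
  by apply/funext => y; rewrite mxE.
by rewrite !E (cderiveZ _ _ _ (CF _)) (cderiveZ _ _ _ (CF _)) mulrBr.
Qed.

Lemma curl_cst (v : 'cV[R[i]]_3) x : curl (fun=> v) x = 0.
Proof. by apply/colP => j; rewrite curlE !cderive_cst subrr mxE. Qed.

Lemma C1_plane_wave_field w (v : 'cV[R[i]]_3) :
  C1_field (fun x => expi (dotp x w) *: v).
Proof. by apply: C1_fieldZ; [exact: C1c_expi|exact: C1_field_cst]. Qed.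

Lemma curl_plane_wave w (v : 'cV[R[i]]_3) x :
  curl (fun x => expi (dotp x w) *: v) x = expi (dotp x w) *: ccross w v.
Proof.
apply/colP => j; rewrite curlE [RHS]mxE ccrossE.
have E k : (fun y => (expi (dotp y w) *: v) k 0) = fun y => v k 0 * expi (dotp y w).
  by apply/funext => y; rewrite mxE mulrC.
have D k u : cderive u (fun y => v k 0 * expi (dotp y w)) x =
    v k 0 * ('i * (dotp u w)%:C * expi (dotp x w)).
  by rewrite cderiveZ ?cderive_expi//; exact: C1c_expi.
by rewrite !E !D !dotp_delta; ring.
Qed.

(** The predicate [P] serves to exclude the wave vector 0 from the sums. *)
Lemma C1_wave_sum (s : seq 'cV[R]_3) (P : pred 'cV[R]_3)
    (b : 'cV[R]_3 -> 'cV[R[i]]_3) :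
  C1_field (fun x => \sum_(w <- s | P w) expi (dotp x w) *: b w).
Proof.
elim: s => [|w s IH].
  rewrite (_ : (fun x => _) = fun=> 0); first exact: C1_field_cst.
  by apply/funext => x; rewrite big_nil.
case Pw: (P w); last first.
  rewrite (_ : (fun x => _) = fun x => \sum_(w <- s | P w) expi (dotp x w) *: b w)//.
  by apply/funext => x; rewrite big_cons Pw.
rewrite (_ : (fun x => _) = fun x => expi (dotp x w) *: b w +
  \sum_(w <- s | P w) expi (dotp x w) *: b w); last first.
  by apply/funext => x; rewrite big_cons Pw.
by apply: C1_fieldD => //; exact: C1_plane_wave_field.
Qed.

Lemma curl_wave_sum (s : seq 'cV[R]_3) (P : pred 'cV[R]_3)
    (b : 'cV[R]_3 -> 'cV[R[i]]_3) x :
  curl (fun x => \sum_(w <- s | P w) expi (dotp x w) *: b w) x =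
  \sum_(w <- s | P w) expi (dotp x w) *: ccross w (b w).
Proof.
elim: s => [|w s IH].
  rewrite (_ : (fun x => _) = fun=> 0); first by rewrite curl_cst big_nil.
  by apply/funext => y; rewrite big_nil.
rewrite big_cons; case Pw: (P w); last first.
  rewrite -IH; congr (curl _ x).
  by apply/funext => y; rewrite big_cons Pw.
rewrite (_ : (fun x => _) = fun x => expi (dotp x w) *: b w +
  \sum_(w <- s | P w) expi (dotp x w) *: b w); last first.
  by apply/funext => y; rewrite big_cons Pw.
rewrite (curlD _ (C1_plane_wave_field _ _) (C1_wave_sum _ _ _)) IH.
by rewrite curl_plane_wave.
Qed.

Definition continuous_field F := forall j,
  continuous (fun x => complex.Re (F x j 0)) /\
  continuous (fun x => complex.Im (F x j 0)).

(** The real and imaginary parts of each component of the curl are differences of two partial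
    derivatives, which is [pointwise_limit_curl] with [u] and [v] coordinate directions. *)
Lemma curl_cvg_field (Fn : nat -> 'cV[R]_3 -> 'cV[R[i]]_3) F G :
  (forall n, C1_field (Fn n)) -> C1_field F -> cvg_field Fn F ->
  cvg_field (fun n => curl (Fn n)) G -> continuous_field G ->
  forall x, curl F x = G x.
Proof.
move=> CFn CF FnF cG ctG x; apply/colP => j; rewrite curlE; apply: complex_eqP.
- rewrite Re_add Re_opp/=.
  apply: (@pointwise_limit_curl _ _ (delta_mx (j + 1) 0) (delta_mx (j + 2) 0)
    (fun n y => complex.Re (Fn n y (j + 1) 0))
    (fun n y => complex.Re (Fn n y (j + 2) 0))
    (fun y => complex.Re (F y (j + 1) 0)) (fun y => complex.Re (F y (j + 2) 0))
    (fun y => complex.Re (G y j 0))).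
  + by move=> n; exact: (CFn n _).1.
  + by move=> n; exact: (CFn n _).1.
  + exact: (CF _).1.
  + exact: (CF _).1.
  + by move=> y; exact: (FnF y _).1.
  + by move=> y; exact: (FnF y _).1.
  + move=> y; have := (cG y j).1.
    by under eq_fun do rewrite curlE Re_add Re_opp/=.
  + exact: (ctG j).1.
- rewrite Im_add Im_opp/=.
  apply: (@pointwise_limit_curl _ _ (delta_mx (j + 1) 0) (delta_mx (j + 2) 0)
    (fun n y => complex.Im (Fn n y (j + 1) 0))
    (fun n y => complex.Im (Fn n y (j + 2) 0))
    (fun y => complex.Im (F y (j + 1) 0)) (fun y => complex.Im (F y (j + 2) 0))
    (fun y => complex.Im (G y j 0))).
  + by move=> n; exact: (CFn n _).2.
  + by move=> n; exact: (CFn n _).2.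
  + exact: (CF _).2.
  + exact: (CF _).2.
  + by move=> y; exact: (FnF y _).2.
  + by move=> y; exact: (FnF y _).2.
  + move=> y; have := (cG y j).2.
    by under eq_fun do rewrite curlE Im_add Im_opp/=.
  + exact: (ctG j).2.
Qed.

End Curl.

(** * Eigenvectors of the symbol of the curl *)

Section EigenvectorAlgebra.
Context {R : realType}.
Implicit Types (w : 'cV[R]_3) (d j k : 'I_3).

Lemma ord3_ind (P : 'I_3 -> Prop) : P 0 -> P 1 -> P 2 -> forall j, P j.
Proof.
move=> P0 P1 P2 [[|[|[|//]]] lt3].
- by rewrite (_ : Ordinal lt3 = 0)//; apply: val_inj.
- by rewrite (_ : Ordinal lt3 = 1)//; apply: val_inj.
- by rewrite (_ : Ordinal lt3 = 2)//; apply: val_inj.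
Qed.

Lemma ord3D : ((0 + 1)%R = 1%R :> 'I_3) * ((0 + 2)%R = 2%R :> 'I_3) *
  ((1 + 1)%R = 2%R :> 'I_3) * ((1 + 2)%R = 0%R :> 'I_3) *
  ((2 + 1)%R = 0%R :> 'I_3) * ((2 + 2)%R = 1%R :> 'I_3).
Proof. by do !split; apply: val_inj. Qed.

Lemma sum_ord3 (V : zmodType) (F : 'I_3 -> V) : \sum_j F j = F 0 + F 1 + F 2.
Proof.
rewrite !big_ord_recl big_ord0 addr0 addrA.
by congr (F _ + F _ + F _); apply: val_inj.
Qed.

Lemma enorm_ge0 w : 0 <= enorm w.
Proof. exact: sqrtr_ge0. Qed.

Lemma sqr_enorm w : enorm w ^+ 2 = w 0 0 ^+ 2 + w 1 0 ^+ 2 + w 2 0 ^+ 2.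
Proof.
by rewrite sqr_sqrtr ?sum_ord3// !addr_ge0// sqr_ge0.
Qed.

Lemma enorm_gt0 w : w != 0 -> 0 < enorm w.
Proof.
move=> w0; rewrite lt_neqAle enorm_ge0 andbT eq_sym; apply: contra w0 => /eqP N0.
have := sqr_enorm w; rewrite N0 expr0n/= => /esym/eqP.
rewrite !paddr_eq0 ?addr_ge0 ?sqr_ge0// !sqrf_eq0 => /andP[/andP[/eqP w0 /eqP w1] /eqP w2].
by apply/eqP/colP; apply: ord3_ind; rewrite mxE.
Qed.

Lemma csumE w : csum w = w 0 0 + w 1 0 + w 2 0.
Proof. exact: sum_ord3. Qed.

Lemma rvecE w j : rvec w j 0 = w (j + 1) 0 - w (j + 2) 0.
Proof. by rewrite mxE. Qed.

Lemma mu1 w : mu w 1 = - enorm w. Proof. by []. Qed.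
Lemma mu2 w : mu w 2 = enorm w. Proof. by []. Qed.

Lemma sqr_mu w d : d != 0 -> mu w d ^+ 2 = enorm w ^+ 2.
Proof. by move: d; apply: ord3_ind => // _; rewrite ?mu1 ?mu2 ?sqrrN. Qed.

Lemma eigvec0E w j : eigvec w 0 j 0 = ((enorm w)^-1 * w j 0)%:C.
Proof. by rewrite /eigvec eqxx !mxE. Qed.

Lemma eigvec_genericE w d j : rvec w != 0 -> d != 0 ->
  eigvec w d j 0 = ((nu w)^-1 * (csum w / enorm w ^+ 2 * w j 0 - 1)) +i*
    (- ((nu w)^-1 * (mu w d / enorm w ^+ 2 * rvec w j 0))).
Proof.
move=> r0 d0; rewrite /eigvec (negPf d0) r0.
rewrite [LHS]mxE [X in _ * X]mxE [X in _ * (_ + X)]mxE [X in _ * (_ - X)]mxE.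
rewrite [cplx (rvec w) _ _]mxE [cplx _ _ _]mxE [(_ - const_mx 1) _ _]mxE.
rewrite [(_ *: w) _ _]mxE [(- const_mx 1) _ _]mxE [const_mx 1 _ _]mxE.
by apply: complex_eqP; rewrite ?cplx_mulE/=; ring.
Qed.

(** Real and imaginary parts of [diag_eigvec] with the factor $1/\sqrt3$ multiplied out. Up to a
    common factor the entries are $\zeta^2,\zeta,1$ with $\zeta=e^{2\pi i/3}$. *)
Definition diag_re j : R := [:: Num.sqrt 3 / 6; Num.sqrt 3 / 6; - (Num.sqrt 3 / 3)]`_j.
Definition diag_im j : R := [:: 1 / 2; - (1 / 2); 0]`_j.

Lemma sqr_sqrt3 : Num.sqrt 3 ^+ 2 = 3 :> R.
Proof. by rewrite sqr_sqrtr. Qed.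

Lemma diag_eigvecE j : diag_eigvec j 0 = diag_re j +i* diag_im j :> R[i].
Proof.
have S0 : Num.sqrt 3 != 0 :> R by rewrite gt_eqF// sqrtr_gt0.
have T : (Num.sqrt 3)^-1 = Num.sqrt 3 / 3 :> R.
  by rewrite -{3}sqr_sqrt3; field.
rewrite /diag_eigvec [LHS]mxE [X in _ * X]mxE /diag_re /diag_im.
move: j; apply: ord3_ind; rewrite ?cplx_mulE /=; apply: complex_eqP => /=.
all: by rewrite T; have := sqr_sqrt3; move: (Num.sqrt 3) => S SE; nra.
Qed.

Lemma rvec0_const w j : rvec w = 0 -> w j 0 = w 0 0.
Proof.
move=> r0.
have r k : w (k + 1) 0 = w (k + 2) 0 by apply/eqP; rewrite -subr_eq0 -rvecE r0 mxE.
have := r 0; have := r 1; rewrite !ord3D => E1 E2.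
by move: j; apply: ord3_ind; rewrite ?E2 ?E1.
Qed.

Lemma enorm_diag w : rvec w = 0 -> enorm w = Num.sqrt 3 * `|w 0 0|.
Proof.
move=> r0; rewrite /enorm sum_ord3 !(rvec0_const _ r0).
rewrite (_ : _ + _ = 3 * w 0 0 ^+ 2); last by ring.
by rewrite sqrtrM// sqrtr_sqr.
Qed.

Lemma conjvE (v : 'cV[R[i]]_3) j : conjv v j 0 = (v j 0)^*.
Proof. by rewrite mxE. Qed.

(* [t] is the sign of the common component of [w]. *)
Lemma eigvec_diagE w : w != 0 -> rvec w = 0 -> exists t : R,
  [/\ t ^+ 2 = 1, enorm w = t * Num.sqrt 3 * w 0 0,
      forall j, eigvec w 1 j 0 = diag_re j +i* (t * diag_im j) &
      forall j, eigvec w 2 j 0 = diag_re j +i* (- t * diag_im j)].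
Proof.
move=> w0 r0; exists (if 0 <= w 0 0 then 1 else -1).
rewrite enorm_diag// /eigvec r0 eqxx /=.
case: ifPn => [h0|]; last rewrite -ltNge => h0.
- split=> [ | |j|j]; rewrite ?expr1n ?ger0_norm// ?mul1r//.
  + by rewrite diag_eigvecE.
  + by rewrite conjvE diag_eigvecE/= mulN1r.
- split=> [ | |j|j]; rewrite ?sqrrN ?expr1n ?ltr0_norm//.
  + by rewrite mulN1r mulrN mulNr.
  + by rewrite conjvE diag_eigvecE/= mulN1r.
  + by rewrite !conjvE diag_eigvecE/= !opprK mul1r.
Qed.

(* Otherwise unification unfolds [eigvec w d] to compare different [d]. *)
Opaque eigvec mu.

Lemma sqr_nu w : w != 0 -> nu w ^+ 2 = 2 * enorm (rvec w) ^+ 2 / enorm w ^+ 2.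
Proof.
by move=> w0; rewrite /nu expr_div_n exprMn sqr_sqrtr.
Qed.

(** Put $p=(s/|w|^2)w-(1,1,1)^T$ and $r=w\times(1,1,1)^T$, which is [rvec w]. Then $w/|w|$,
    $|w|p/|r|$, $r/|r|$ is a real orthonormal basis, and [E] is its completeness relation.
    Orthonormality is stated as $VV^\dagger=1$, the form that recovers a vector from its
    coefficients. *)
Lemma eigvec_generic_orthonormal w j k : w != 0 -> rvec w != 0 ->
  \sum_d eigvec w d j 0 * (eigvec w d k 0)^* = (j == k)%:R.
Proof.
move=> w0 r0; rewrite sum_ord3.
rewrite (eigvec0E w j) (eigvec0E w k).
have n1 : (1 : 'I_3) != 0 by [].
have n2 : (2 : 'I_3) != 0 by [].
rewrite !(eigvec_genericE _ r0 n1) !(eigvec_genericE _ r0 n2).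
rewrite (mu1 w) (mu2 w).
have N0 := enorm_gt0 w0; have Q0 := enorm_gt0 r0.
have n0 : (nu w)^-1 ^+ 2 = enorm w ^+ 2 / (2 * enorm (rvec w) ^+ 2).
  by rewrite exprVn sqr_nu// invf_div.
have E : enorm w ^- 2 * (w j 0 * w k 0) + enorm w ^+ 2 / enorm (rvec w) ^+ 2 *
   ((csum w / enorm w ^+ 2 * w j 0 - 1) * (csum w / enorm w ^+ 2 * w k 0 - 1) +
   enorm w ^- 2 * (rvec w j 0 * rvec w k 0)) = (j == k)%:R.
  have M0 : enorm w ^+ 2 != 0 by rewrite sqrf_eq0 gt_eqF.
  have P0 : enorm (rvec w) ^+ 2 != 0 by rewrite sqrf_eq0 gt_eqF.
  move: M0 P0; rewrite !rvecE csumE !sqr_enorm !rvecE !ord3D.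
  by move: j k; apply: ord3_ind; apply: ord3_ind; rewrite !ord3D/= => M0 P0;
    field; rewrite M0 P0.
move: n0 N0 Q0 E; set nv := (nu w)^-1; set M := enorm w; set Q := enorm (rvec w).
set u := _ - 1; set v := _ - 1.
move: (w j 0) (w k 0) (rvec w j 0) (rvec w k 0) => a b p q n0 N0 Q0 E.
have M0 : M != 0 by rewrite gt_eqF.
have P0 : Q != 0 by rewrite gt_eqF.
rewrite -[RHS](rmorph_nat (real_complex R)) -E.
(* The imaginary parts from the two transverse eigenvectors cancel because [mu] changes sign between
   them; their real parts are equal and add up. *)
apply: complex_eqP; rewrite !cplx_mulE /=; last by field.
transitivity (M ^- 2 * (a * b) + nv ^+ 2 * 2 * (u * v + M ^- 2 * (p * q))).
  by field.
by rewrite n0; field; rewrite P0 M0.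
Qed.

(** With $p$ and $r$ as above, $w\times r=|w|^2p$ ([E1]) and $w\times p=-r$ ([E2]). Hence the symbol
    maps $p-i(\mu/|w|^2)r$ to $\mu p-ir$, which is $\mu$ times that vector since $\mu^2=|w|^2$. *)
Lemma ccross_eigvec_generic w d : w != 0 -> rvec w != 0 -> d != 0 ->
  ccross w (eigvec w d) = (mu w d)%:C *: eigvec w d.
Proof.
move=> w0 r0 d0; apply/colP => j; rewrite ccrossE [RHS]mxE.
rewrite !(eigvec_genericE _ r0 d0).
have M0 : enorm w ^+ 2 != 0 by rewrite sqrf_eq0 gt_eqF ?enorm_gt0.
have := sqr_mu w d0; move: (mu w d) => m mE.
move: (nu w)^-1 => nv.
have E1 : w (j + 1) 0 * rvec w (j + 2) 0 - w (j + 2) 0 * rvec w (j + 1) 0 =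
    enorm w ^+ 2 * (csum w / enorm w ^+ 2 * w j 0 - 1).
  rewrite csumE mulrBr mulrA mulrCA divff// !mulr1 sqr_enorm !rvecE.
  by move: j; apply: ord3_ind; rewrite !ord3D; ring.
have E2 : w (j + 1) 0 * (csum w / enorm w ^+ 2 * w (j + 2) 0 - 1) -
    w (j + 2) 0 * (csum w / enorm w ^+ 2 * w (j + 1) 0 - 1) = - rvec w j 0.
  by rewrite rvecE; ring.
apply: complex_eqP; rewrite /= ?(mul0r, mulr0, addr0, add0r, sub0r, subr0, mul1r).
- transitivity (nv * (m / enorm w ^+ 2) * (w (j + 1) 0 * rvec w (j + 2) 0
    - w (j + 2) 0 * rvec w (j + 1) 0)); first by ring.
  by rewrite E1; field; rewrite gt_eqF ?enorm_gt0.
- transitivity (nv * (w (j + 1) 0 * (csum w / enorm w ^+ 2 * w (j + 2) 0 - 1) -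
    w (j + 2) 0 * (csum w / enorm w ^+ 2 * w (j + 1) 0 - 1))); first by ring.
  rewrite E2 -[LHS]mulr1 -(divff M0) -{1}mE.
  by ring.
Qed.

Lemma eigvec_diag_orthonormal w j k : w != 0 -> rvec w = 0 ->
  \sum_d eigvec w d j 0 * (eigvec w d k 0)^* = (j == k)%:R.
Proof.
move=> w0 r0; rewrite sum_ord3 (eigvec0E w j) (eigvec0E w k).
have [t [t2 NE E1 E2]] := eigvec_diagE w0 r0.
rewrite !E1 !E2 !(rvec0_const _ r0).
have N0 : enorm w != 0 by rewrite gt_eqF ?enorm_gt0.
have S3 := sqr_sqrt3.
(* As [w] is a multiple of $(1,1,1)^T$, the longitudinal vector contributes $1/3$ to every entry.
   The other two contribute through $t^2=1$ only. *)
have N2 : ((enorm w)^-1 * w 0 0) ^+ 2 = 1 / 3.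
  rewrite exprMn exprVn.
  have E : enorm w ^+ 2 = 3 * w 0 0 ^+ 2.
    by rewrite sqr_enorm !(rvec0_const _ r0); ring.
  have : 3 * w 0 0 ^+ 2 != 0 by rewrite -E sqrf_eq0.
  rewrite E; move: (w 0 0 ^+ 2) => q; rewrite mulf_eq0 negb_or => /andP[_ q0].
  by field.
rewrite -[RHS](rmorph_nat (real_complex R)).
apply: complex_eqP; rewrite !cplx_mulE /=; last by ring.
transitivity (((enorm w)^-1 * w 0 0) ^+ 2 +
  2 * (diag_re j * diag_re k + t ^+ 2 * (diag_im j * diag_im k))); first by ring.
rewrite N2 t2 /diag_re /diag_im; move: S3; move: (Num.sqrt 3) => S S3.
by move: j k; apply: ord3_ind; apply: ord3_ind => /=; nra.
Qed.

(** Here the symbol is $i\omega$ times the cyclic difference $v_{j+2}-v_{j+1}$. The entries of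
    [diag_eigvec] are geometric with ratio $\zeta^{-1}$, so the difference multiplies it by
    $\zeta-\zeta^2=i\sqrt3$; [D2] and [D1] are the real and imaginary parts of this relation. *)
Lemma ccross_eigvec_diag w d : w != 0 -> rvec w = 0 -> d != 0 ->
  ccross w (eigvec w d) = (mu w d)%:C *: eigvec w d.
Proof.
move=> w0 r0 d0; apply/colP => j; rewrite ccrossE [RHS]mxE.
have [t [t2 NE E1 E2]] := eigvec_diagE w0 r0.
rewrite !(rvec0_const _ r0).
have S3 := sqr_sqrt3.
have D1 : diag_im (j + 2) - diag_im (j + 1) = Num.sqrt 3 * diag_re j.
  rewrite /diag_re /diag_im; move: S3; move: (Num.sqrt 3) => S S3.
  by move: j; apply: ord3_ind => /=; nra.
have D2 : diag_re (j + 2) - diag_re (j + 1) = - (Num.sqrt 3 * diag_im j).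
  clear D1; rewrite /diag_re /diag_im; move: S3; move: (Num.sqrt 3) => S S3.
  by move: j; apply: ord3_ind => /=; nra.
(* The two transverse vectors are conjugate to each other; the sign [s], equal to [t] or [- t],
   treats them together. *)
have [s [s2 -> E]] : exists s : R, [/\ s ^+ 2 = 1,
    mu w d = - (s * Num.sqrt 3 * w 0 0) &
    forall j, eigvec w d j 0 = diag_re j +i* (s * diag_im j)].
  move: d d0; apply: ord3_ind => // _.
    by exists t; rewrite mu1 NE.
  by exists (- t); rewrite mu2 NE sqrrN !mulNr opprK.
rewrite !E; move: (w 0 0) => o; apply: complex_eqP => /=.
- rewrite ?(mul0r, mulr0, addr0, add0r, sub0r, subr0, mul1r).
  transitivity (- (o * s * (diag_im (j + 2) - diag_im (j + 1)))); first by ring.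
  by rewrite D1; ring.
- rewrite ?(mul0r, mulr0, addr0, add0r, sub0r, subr0, mul1r).
  transitivity (o * (diag_re (j + 2) - diag_re (j + 1))); first by ring.
  rewrite D2 -[LHS]mul1r -{1}s2; ring.
Qed.

Lemma eigvec_orthonormal w j k : w != 0 ->
  \sum_d eigvec w d j 0 * (eigvec w d k 0)^* = (j == k)%:R.
Proof.
move=> w0; have [r0|r0] := eqVneq (rvec w) 0.
  exact: eigvec_diag_orthonormal.
exact: eigvec_generic_orthonormal.
Qed.

Lemma ccross_eigvec w d : w != 0 -> ccross w (eigvec w d) = (mu w d)%:C *: eigvec w d.
Proof.
move=> w0; have [->|d0] := eqVneq d 0.
  have -> : mu w 0 = 0 by [].
  rewrite scale0r; apply/colP => j; rewrite ccrossE !(eigvec0E w) mxE.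
  apply: complex_eqP => /=; ring.
have [r0|r0] := eqVneq (rvec w) 0; first exact: ccross_eigvec_diag.
exact: ccross_eigvec_generic.
Qed.

(** The sum is $VV^\dagger a_w$, and $VV^\dagger=1$ by [eigvec_orthonormal]. *)
Lemma sum_alpha_eigvec (a : 'cV[R]_3 -> 'cV[R[i]]_3) w : w != 0 ->
  \sum_d alpha a w d *: eigvec w d = a w.
Proof.
move=> w0.
have VV : eigmx w *m adjmx (eigmx w) = 1%:M.
  apply/matrixP => j k; rewrite [RHS]mxE -(eigvec_orthonormal j k w0) mxE.
  by apply: eq_bigr => d _; rewrite !mxE.
rewrite -[RHS]mul1mx -VV -mulmxA; apply/colP => j; rewrite summxE [RHS]mxE.
by apply: eq_bigr => d _; rewrite /alpha !mxE mulrC.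
Qed.

End EigenvectorAlgebra.

(** * Curls of the partial sums *)

Section PartialSums.
Context {R : realType}.
Implicit Types (a : 'cV[R]_3 -> 'cV[R[i]]_3) (w : 'cV[R]_3) (A : {fset 'cV[R]_3}).

Lemma ccrossD w u v : ccross w (u + v) = ccross w u + ccross w v :> 'cV[R[i]]_3.
Proof.
apply/colP => j; rewrite [RHS]mxE !ccrossE.
have E k : (u + v) k 0 = u k 0 + v k 0 by rewrite mxE.
by rewrite !E; ring.
Qed.

Lemma ccrossZ w c v : ccross w (c *: v) = c *: ccross w v :> 'cV[R[i]]_3.
Proof.
apply/colP => j; rewrite [RHS]mxE !ccrossE.
have E k : (c *: v) k 0 = c * v k 0 by rewrite mxE.
by rewrite !E; ring.
Qed.

Lemma ccross0 w : ccross w 0 = 0 :> 'cV[R[i]]_3.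
Proof. by have := ccrossZ w 0 0; rewrite !scale0r. Qed.

(** Regrouping by wave vector brings the double sum into the form of [C1_wave_sum] and
    [curl_wave_sum]. *)
Lemma psi_psumE a A : psi_psum a A = fun x =>
  \sum_(w <- A | w != 0) expi (dotp x w) *:
    \sum_(d < 3 | d != 0) (((mu w d)^-1)%:C * alpha a w d) *: eigvec w d.
Proof.
apply/funext => x; apply: eq_bigr => w _; rewrite scaler_sumr.
by apply: eq_bigr => d _; rewrite scalerA mulrC.
Qed.

Lemma phi_psumE a A : phi_psum a A = fun x => a 0 +
  \sum_(w <- A | w != 0) expi (dotp x w) *: (alpha a w 0 *: eigvec w 0).
Proof.
apply/funext => x; congr (_ + _); apply: eq_bigr => w _.
by rewrite scalerA mulrC.
Qed.

Lemma C1_psi_psum a A : C1_field (psi_psum a A).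
Proof. by rewrite psi_psumE; exact: C1_wave_sum. Qed.

Lemma C1_phi_psum a A : C1_field (phi_psum a A).
Proof.
rewrite phi_psumE; apply: C1_fieldD; first exact: C1_field_cst.
exact: C1_wave_sum.
Qed.

Lemma curl_phi_psum a A x : curl (phi_psum a A) x = 0.
Proof.
rewrite phi_psumE (curlD _ (C1_field_cst _ _) (C1_wave_sum _ _ _)) curl_cst add0r.
rewrite curl_wave_sum big1// => w w0.
by rewrite ccrossZ ccross_eigvec// scale0r !scaler0.
Qed.

Lemma mu_neq0 w d : w != 0 -> d != 0 -> mu w d != 0.
Proof.
move=> w0 d0; rewrite -sqrf_eq0 sqr_mu// sqrf_eq0 gt_eqF//; exact: enorm_gt0.
Qed.

(** Each transverse wave is an eigenfunction of the curl with eigenvalue [mu w d], nonzero here,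
    which cancels the factor $1/\mu$. *)
Lemma curl_psi_psum a A x : curl (psi_psum a A) x =
  \sum_(w <- A | w != 0) expi (dotp x w) *:
    \sum_(d < 3 | d != 0) alpha a w d *: eigvec w d.
Proof.
rewrite psi_psumE curl_wave_sum; apply: eq_bigr => w w0; congr (_ *: _).
rewrite (big_morph _ (ccrossD w) (ccross0 w)); apply: eq_bigr => d d0.
rewrite ccrossZ ccross_eigvec// scalerA mulrAC -rmorphM mulVf ?mul1r//.
exact: mu_neq0.
Qed.

(** [phi_psum] contains the constant [a 0] for every [A], whereas [fourier_psum] contains it only
    when the wave vector 0 lies in [A]. The hypothesis reconciles the two. *)
Lemma curl_psi_psum_fourier a A x : (a 0 != 0 -> 0 \in A) ->
  curl (psi_psum a A) x = fourier_psum a A x - phi_psum a A x.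
Proof.
move=> A0; have E0 : expi (dotp x 0) = 1 :> R[i].
  rewrite /dotp big1 ?/expi ?cos0 ?sin0// => j _.
  by rewrite mxE mulr0.
have -> : fourier_psum a A x =
    a 0 + \sum_(w <- A | w != 0) expi (dotp x w) *: a w.
  rewrite /fourier_psum; have [A1|nA] := boolP (0 \in A).
    by rewrite (bigD1_seq 0)//= ?fset_uniq// E0 scale1r.
  have -> : a 0 = 0 by apply/eqP; apply: contraNT nA.
  rewrite add0r big_seq_cond [RHS]big_seq_cond; apply: eq_bigl => w.
  rewrite andbT; have [wA|//] := boolP (w \in A).
  by symmetry; apply: contraNneq nA => <-.
rewrite curl_psi_psum phi_psumE opprD addrACA subrr add0r -sumrB.
apply: eq_bigr => w w0; rewrite -scalerBr; congr (_ *: _).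
have := sum_alpha_eigvec a w0; rewrite (bigD1 0)//= => <-.
by rewrite [RHS]addrC addKr.
Qed.

End PartialSums.

(** * Passage to the limit in the series *)

Section FieldLimits.
Context {R : realType}.
Implicit Types (a : 'cV[R]_3 -> 'cV[R[i]]_3).

Lemma cvg_fieldB (F G : nat -> 'cV[R]_3 -> 'cV[R[i]]_3) f g :
  cvg_field F f -> cvg_field G g ->
  cvg_field (fun n x => F n x - G n x) (fun x => f x - g x).
Proof.
move=> Ff Gg x j; have [F1 F2] := Ff x j; have [G1 G2] := Gg x j.
have E (u v : 'cV[R[i]]_3) : (u - v) j 0 = u j 0 + - v j 0 by rewrite !mxE.
split; rewrite E ?(Re_add, Im_add) ?(Re_opp, Im_opp).
  under eq_fun do rewrite E Re_add Re_opp.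
  by apply: cvgB.
under eq_fun do rewrite E Im_add Im_opp.
by apply: cvgB.
Qed.

Lemma cvg_field_eventually (F G : nat -> 'cV[R]_3 -> 'cV[R[i]]_3) f N :
  (forall n, (N <= n)%N -> F n = G n) -> cvg_field F f -> cvg_field G f.
Proof.
move=> FG Ff x j; have [F1 F2] := Ff x j.
by split; [apply: cvg_trans F1|apply: cvg_trans F2]; apply: near_eq_cvg;
  exists N => // n /= Nn; rewrite FG.
Qed.

Lemma C1_continuous_field (F : 'cV[R]_3 -> 'cV[R[i]]_3) :
  C1_field F -> continuous_field F.
Proof.
by move=> CF j; have [C1 C2] := CF j; split; exact: C1_continuous.
Qed.

Lemma curl_phi a W phi : cvg_field (fun n => phi_psum a (W n)) phi ->
  C1_field phi -> forall x, curl phi x = 0 :> 'cV[R[i]]_3.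
Proof.
move=> cphi Cphi; apply: (curl_cvg_field (fun n => C1_phi_psum a (W n)) Cphi cphi).
- move=> x j; rewrite mxE; under eq_fun do rewrite curl_phi_psum mxE.
  under [X in _ /\ X @ _ --> _]eq_fun do rewrite curl_phi_psum mxE.
  by split; exact: cvg_cst.
- by apply: C1_continuous_field; exact: C1_field_cst.
Qed.

Lemma curl_psi a W J phi psi : exhausts a W ->
  cvg_field (fun n => fourier_psum a (W n)) J ->
  cvg_field (fun n => phi_psum a (W n)) phi ->
  cvg_field (fun n => psi_psum a (W n)) psi ->
  C1_field J -> C1_field phi -> C1_field psi ->
  forall x, curl psi x = J x - phi x :> 'cV[R[i]]_3.
Proof.
move=> [Wmono Wex] cJ cphi cpsi CJ Cphi Cpsi.
apply: (curl_cvg_field (fun n => C1_psi_psum a (W n)) Cpsi cpsi).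
(* [exhausts] guarantees the wave vector 0 only from some index on, and only if [a 0] is nonzero, so
   the formula for the curl is available eventually. Monotonicity of [W] keeps 0 in all later
   sets. *)
- have [N HN] : exists N, forall n, (N <= n)%N -> a 0 != 0 -> 0 \in W n.
    have [a0|a0] := eqVneq (a 0) 0.
      by exists 0%N.
    have [N WN] := Wex _ a0; exists N => n Nn _.
    exact: (fsubsetP (Wmono _ _ Nn)).
  apply: (cvg_field_eventually _ (cvg_fieldB cJ cphi) (N := N)) => n Nn.
  by apply/funext => x; rewrite curl_psi_psum_fourier//; exact: HN.
- apply: C1_continuous_field; apply: C1_fieldD => //.
  have := C1_fieldZ (C1c_cst _ (-1)) Cphi.
  by under eq_fun do rewrite scaleN1r.
Qed.

End FieldLimits.

(** * Superposition and a particular solution of the Maxwell system *)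

Section Maxwell.
Context {R : realType}.
Implicit Types (X Y : normedModType R).

Lemma differentiable_fst X Y (p : X * Y) : differentiable (@fst X Y) p.
Proof.
apply: linear_differentiable => q; exact: cvg_fst.
Qed.

Lemma differentiable_snd X Y (p : X * Y) : differentiable (@snd X Y) p.
Proof.
apply: linear_differentiable => q; exact: cvg_snd.
Qed.

Lemma C1_fst X Y (f : X -> R) : C1 f -> C1 (fun p : X * Y => f p.1).
Proof.
move=> [df cf]; split=> [p|v p].
  exact: (differentiable_comp (differentiable_fst p) (df _)).
exact: (@continuous_comp _ _ _ fst _ p (@cvg_fst _ _ _ _ _) (cf v.1 _)).
Qed.

Lemma C1_snd X Y (f : Y -> R) : C1 f -> C1 (fun p : X * Y => f p.2).
Proof.
move=> [df cf]; split=> [p|v p].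
  exact: (differentiable_comp (differentiable_snd p) (df _)).
exact: (@continuous_comp _ _ _ snd _ p (@cvg_snd _ _ _ _ _) (cf v.2 _)).
Qed.

Lemma differentiable_idfun X (x : X) : differentiable (fun x : X => x) x.
Proof. by apply: (@linear_differentiable _ _ _ idfun) => y; exact: cvg_id. Qed.

Lemma C1_id : C1 (fun t : R => t).
Proof.
split=> [t|v]; first exact: differentiable_idfun.
have -> : (fun x => 'D_v (fun t : R => t) x) = cst v.
  by apply/funext => t; exact: derive_id.
by move=> t; exact: cvg_cst.
Qed.

(** [maxwell] asks for regularity jointly in space and time, while [curl] and [time_deriv] act on
    slices. The derivative of this slice along [v] is that of [f] along [(v, 0)]. *)
Lemma C1_slicel X Y (f : X * Y -> R) (y : Y) : C1 f -> C1 (fun x => f (x, y)).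
Proof.
move=> [df cf].
have dp x : differentiable (fun x : X => (x, y)) x.
  exact: (differentiable_pair (differentiable_idfun _) (differentiable_cst _ _)).
split=> [x|v].
  exact: (differentiable_comp (dp x) (df _)).
have -> : (fun x => 'D_v (fun x => f (x, y)) x) = (fun x => 'D_(v, 0) f (x, y)).
  apply/funext => x.
  have E : (fun h : R => h^-1 *: (((fun x => f (x, y)) \o shift x) (h *: v)
        - f (x, y))) =
      (fun h => h^-1 *: ((f \o shift (x, y)) (h *: (v, 0)) - f (x, y))).
    apply/funext => h /=; congr (_ *: (f _ - _)).
    by apply: injective_projections; rewrite /= ?scaler0 ?add0r.
  by rewrite /derive E.
move=> x; exact: (continuous_comp (differentiable_continuous (dp x)) (cf _ _)).
Qed.

Lemma C1_slicer X Y (f : X * Y -> R) (x : X) : C1 f -> C1 (fun y => f (x, y)).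
Proof.
move=> [df cf].
have dp y : differentiable (fun y : Y => (x, y)) y.
  exact: (differentiable_pair (differentiable_cst _ _) (differentiable_idfun _)).
split=> [y|v].
  exact: (differentiable_comp (dp y) (df _)).
have -> : (fun y => 'D_v (fun y => f (x, y)) y) = (fun y => 'D_(0, v) f (x, y)).
  apply/funext => y.
  have E : (fun h : R => h^-1 *: (((fun y => f (x, y)) \o shift y) (h *: v)
        - f (x, y))) =
      (fun h => h^-1 *: ((f \o shift (x, y)) (h *: (0, v)) - f (x, y))).
    apply/funext => h /=; congr (_ *: (f _ - _)).
    by apply: injective_projections; rewrite /= ?scaler0 ?add0r.
  by rewrite /derive E.
move=> y; exact: (continuous_comp (differentiable_continuous (dp y)) (cf _ _)).
Qed.

Lemma C1_field_slicel X Y (F : X -> Y -> 'cV[R[i]]_3) (y : Y) :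
  C1_field (fun p : X * Y => F p.1 p.2) -> C1_field (fun x => F x y).
Proof.
move=> CF j; have [C1 C2] := CF j; split.
  exact: (C1_slicel y C1).
exact: (C1_slicel y C2).
Qed.

Lemma C1_field_slicer X Y (F : X -> Y -> 'cV[R[i]]_3) (x : X) :
  C1_field (fun p : X * Y => F p.1 p.2) -> C1_field (F x).
Proof.
move=> CF j; have [C1 C2] := CF j; split.
  exact: (C1_slicer x C1).
exact: (C1_slicer x C2).
Qed.

Lemma C1_field_fst X Y (F : X -> 'cV[R[i]]_3) :
  C1_field F -> C1_field (fun p : X * Y => F p.1).
Proof.
by move=> CF j; have [C1 C2] := CF j; split; [exact: (C1_fst Y C1)|exact: (C1_fst Y C2)].
Qed.

Lemma time_derivE (f : R -> 'cV[R[i]]_3) t j :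
  time_deriv f t j 0 = cderive (1 : R) (fun s => f s j 0) t.
Proof. by rewrite mxE !derive1E. Qed.

Lemma time_derivD (f g : R -> 'cV[R[i]]_3) t : C1_field f -> C1_field g ->
  time_deriv (fun s => f s + g s) t = time_deriv f t + time_deriv g t.
Proof.
move=> Cf Cg; apply/colP => j; rewrite [RHS]mxE !time_derivE.
have E : (fun s => (f s + g s) j 0) = fun s => f s j 0 + g s j 0.
  by apply/funext => s; rewrite mxE.
by rewrite E; exact: (cderiveD _ _ (Cf j) (Cg j)).
Qed.

Lemma time_derivZ (c : R[i]) (f : R -> 'cV[R[i]]_3) t : C1_field f ->
  time_deriv (fun s => c *: f s) t = c *: time_deriv f t.
Proof.
move=> Cf; apply/colP => j; rewrite [RHS]mxE !time_derivE.
have E : (fun s => (c *: f s) j 0) = fun s => c * f s j 0.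
  by apply/funext => s; rewrite mxE.
by rewrite E; exact: (cderiveZ _ _ _ (Cf j)).
Qed.

Lemma time_deriv_cst (v : 'cV[R[i]]_3) t : time_deriv (fun=> v) t = 0.
Proof. by apply/colP => j; rewrite time_derivE cderive_cst mxE. Qed.

Lemma time_deriv_linear (v : 'cV[R[i]]_3) t :
  time_deriv (fun s => (- s)%:C *: v) t = - v.
Proof.
apply/colP => j; rewrite [RHS]mxE time_derivE.
have E : (fun s : R => ((- s)%:C *: v) j 0) = fun s => (- v j 0) * s%:C.
  by apply/funext => s; rewrite mxE rmorphN mulNr mulrC mulNr.
have C : C1c (fun s : R => s%:C) by split; [exact: C1_id|exact: C1_cst].
rewrite E cderiveZ// /cderive/= derive_id derive_cst.
by rewrite complexr0 mulr1.
Qed.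

Implicit Types G A B : 'cV[R]_3 -> 'cV[R[i]]_3.
Implicit Types H E : 'cV[R]_3 -> R -> 'cV[R[i]]_3.

Lemma maxwellD G1 A1 B1 H1 E1 G2 A2 B2 H2 E2 :
  maxwell G1 A1 B1 H1 E1 -> maxwell G2 A2 B2 H2 E2 ->
  maxwell (fun x => G1 x + G2 x) (fun x => A1 x + A2 x) (fun x => B1 x + B2 x)
    (fun x t => H1 x t + H2 x t) (fun x t => E1 x t + E2 x t).
Proof.
move=> [[CH1 CE1] Ht1 Et1 H01 E01] [[CH2 CE2] Ht2 Et2 H02 E02]; split.
- split; [exact: (C1_fieldD CH1 CH2)|exact: (C1_fieldD CE1 CE2)].
- move=> x t.
  rewrite (time_derivD _ (C1_field_slicer x CH1) (C1_field_slicer x CH2)).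
  rewrite (curlD _ (C1_field_slicel t CE1) (C1_field_slicel t CE2)).
  by rewrite Ht1 Ht2 opprD.
- move=> x t.
  rewrite (time_derivD _ (C1_field_slicer x CE1) (C1_field_slicer x CE2)).
  rewrite (curlD _ (C1_field_slicel t CH1) (C1_field_slicel t CH2)).
  by rewrite Et1 Et2 opprD addrACA.
- by move=> x; rewrite H01 H02.
- by move=> x; rewrite E01 E02.
Qed.

Lemma maxwellZ (c : R[i]) G A B H E : maxwell G A B H E ->
  maxwell (fun x => c *: G x) (fun x => c *: A x) (fun x => c *: B x)
    (fun x t => c *: H x t) (fun x t => c *: E x t).
Proof.
move=> [[CH CE] Ht Et H0 E0]; split.
- by split; apply: C1_fieldZ => //; exact: C1c_cst.
- move=> x t; rewrite (time_derivZ _ _ (C1_field_slicer x CH)).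
  by rewrite (curlZ _ _ (C1_field_slicel t CE)) Ht scalerN.
- move=> x t; rewrite (time_derivZ _ _ (C1_field_slicer x CE)).
  by rewrite (curlZ _ _ (C1_field_slicel t CH)) Et scalerBr.
- by move=> x; rewrite H0.
- by move=> x; rewrite E0.
Qed.

(** The magnetic field can stay constant because $t\,\mathrm{curl}\,\phi=0$, and the time derivative
    $-\phi$ of the electric field equals $\mathrm{curl}\,\psi-J$. *)
Lemma maxwell_stationary (J phi psi : 'cV[R]_3 -> 'cV[R[i]]_3) :
  C1_field phi -> C1_field psi ->
  (forall x, curl phi x = 0) -> (forall x, curl psi x = J x - phi x) ->
  maxwell J psi (fun=> 0) (fun x _ => psi x) (fun x t => (- t)%:C *: phi x).
Proof.
move=> Cphi Cpsi cphi cpsi; split.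
- split; first exact: C1_field_fst.
  apply: C1_fieldZ; last exact: C1_field_fst.
  split; last exact: C1_cst.
  exact: (C1N (C1_snd _ C1_id)).
- by move=> x t; rewrite time_deriv_cst curlZ// cphi scaler0 oppr0.
- by move=> x t; rewrite time_deriv_linear cpsi addrAC subrr add0r.
- by [].
- by move=> x; rewrite oppr0 scale0r.
Qed.

End Maxwell.

Unset Implicit Arguments.

(** The second conclusion accounts for the definite article in the claim: uniqueness for the system
    with generator is inherited from the system without it. *)
Theorem theorem3p1 (R : realType)
    (J phi psi H0 E0 : 'cV[R]_3 -> 'cV[R[i]]_3)
    (a : 'cV[R]_3 -> 'cV[R[i]]_3) (W : nat -> {fset 'cV[R]_3})
    (U V E H : 'cV[R]_3 -> R -> 'cV[R[i]]_3) :
  C1_field J ->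
  exhausts a W ->
  cvg_field (fun n => fourier_psum a (W n)) J ->
  cvg_field (fun n => phi_psum a (W n)) phi ->
  cvg_field (fun n => psi_psum a (W n)) psi ->
  C1_field phi ->
  C1_field H0 -> C1_field E0 ->
  maxwell (fun=> 0) (fun x => H0 x - psi x) E0 V U ->
  (forall x t, E x t = U x t - t%:C *: phi x) ->
  (forall x t, H x t = V x t + psi x) ->
  maxwell J H0 E0 H E /\
  ((forall V' U', maxwell (fun=> 0) (fun x => H0 x - psi x) E0 V' U' ->
      V' = V /\ U' = U) ->
   forall H' E', maxwell J H0 E0 H' E' -> H' = H /\ E' = E).
Proof.
move=> CJ exW cJ cphi cpsi Cphi CH0 CE0 VU EE HE.
have [[CV _] _ _ V0 _] := VU.
(* The regularity of [psi] comes from the initial condition: [psi] is the difference of [H0] and the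
   time slice of [V] at 0. *)
have Cpsi : C1_field psi.
  have := C1_fieldD CH0 (C1_fieldZ (C1c_cst _ (-1)) (C1_field_slicel 0 CV)).
  rewrite (_ : (fun x => _) = psi)//; apply/funext => x.
  by rewrite V0 scaleN1r opprB addrC subrK.
have S := maxwell_stationary Cphi Cpsi (curl_phi cphi Cphi)
  (curl_psi exW cJ cphi cpsi CJ Cphi Cpsi).
split.
  have := maxwellD VU S; congr maxwell.
  - by apply/funext => x; rewrite add0r.
  - by apply/funext => x; rewrite subrK.
  - by apply/funext => x; rewrite addr0.
  - by apply/funext => x; apply/funext => t; rewrite HE.
  - by apply/funext => x; apply/funext => t; rewrite EE rmorphN scaleNr.
(* Subtracting the particular solution from any solution leaves a solution without generator and
   with initial fields [H0 - psi] and [E0], which [uniq] identifies with [V] and [U]. *)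
move=> uniq H' E' HE'.
have := maxwellD HE' (maxwellZ (-1) S).
rewrite (_ : (fun x => J x + _) = fun=> 0); last first.
  by apply/funext => x; rewrite scaleN1r subrr.
rewrite (_ : (fun x => H0 x + _) = fun x => H0 x - psi x); last first.
  by apply/funext => x; rewrite scaleN1r.
rewrite (_ : (fun x => E0 x + _) = E0); last first.
  by apply/funext => x; rewrite scaler0 addr0.
move=> /uniq[HV EU]; split; apply/funext => x; apply/funext => t.
  by rewrite HE -HV scaleN1r subrK.
by rewrite EE -EU scaleN1r rmorphN scaleNr opprK addrK.
Qed.
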